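(* Let $n>1$ be an integer, $m_1,m_2>0$, and consider a solution of the $(n+1)$-body problem of the type described in the context. On any open interval of time on which $\dot r$ does not vanish, write $f(t)=g(r(t))$. Then $g=g(r)$ satisfies $$a(r,g,g')\,g''(r)+b(r,g)\,g'(r)+c(r,g)=0,$$ where $k=\frac{m_1+nm_2}{nm_2}$ and $$a(r,g,g')=-\frac{2n^2m_1m_2^2r^2+\big(n^2b_nm_2^3r+2nc_2m_2r^2-n^2c_1^2m_2^2\big)\sqrt{r^2+k^2g(r)^2}}{r^2\sqrt{r^2+k^2g(r)^2}\,\big(n^2m_2^2+m_1(m_1+nm_2)g'(r)^2\big)},$$ $$b(r,g)=-\frac{c_1^2}{r^3}+\frac{m_2a_n}{r^2}+\frac{n(k-1)m_2r}{(r^2+k^2g(r)^2)^{3/2}},\qquad c(r,g)=-\frac{nkm_2g(r)}{(r^2+k^2g(r)^2)^{3/2}} .$$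
   Context: The gravitational constant is $1$. The solutions considered are the solutions of the $(n+1)$-body problem, with one body $x$ of mass $m_1$ and $n$ bodies $y^1,\dots,y^n$ of mass $m_2$, of the form $$x=(0,0,f),\qquad y^j=\Big(r\cos\big(\theta+\tfrac{2(j-1)\pi}{n}\big),\ r\sin\big(\theta+\tfrac{2(j-1)\pi}{n}\big),\ -\tfrac{m_1}{nm_2}f\Big),\quad j=1,\dots,n,$$ where $r>0$ and $$\ddot f=-\frac{(m_1+nm_2)f}{h^3},\qquad \ddot r=\frac{c_1^2}{r^3}-a_n\frac{m_2}{r^2}-\frac{m_1r}{h^3},\qquad r^2\dot\theta=c_1,$$ with $c_1$ a constant, $h=\sqrt{r^2+\big(\frac{m_1+nm_2}{nm_2}\big)^2f^2}$, $$a_n=\sum_{j=1}^{n-1}\frac{1-e^{2\pi ji/n}}{|e^{2\pi ji/n}-1|^3},\qquad b_n=\sum_{j=1}^{n-1}|e^{2\pi ji/n}-1|^{-1}.$$ The number $c_2$ is the conserved total energy (kinetic plus potential): $$c_2=\tfrac12\Big(m_1|\dot x|^2+m_2\sum_{j}|\dot y^j|^2\Big)-\sum_j\frac{m_1m_2}{|x-y^j|}-\sum_{i<j}\frac{m_2^2}{|y^i-y^j|}.$$ *)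

(* Defs.v *)
From Stdlib Require Import Reals Lra Lia.
From Coquelicot Require Import Coquelicot.
Open Scope R_scope.

Definition time_interval (a b : Rbar) (t : R) : Prop :=
  Rbar_lt a t /\ Rbar_lt t b.

Definition R3 : Type := (R * R * R)%type.
Definition X1 (v : R3) : R := fst (fst v).
Definition X2 (v : R3) : R := snd (fst v).
Definition X3 (v : R3) : R := snd v.

Definition add3 (u v : R3) : R3 := (X1 u + X1 v, X2 u + X2 v, X3 u + X3 v).
Definition sub3 (u v : R3) : R3 := (X1 u - X1 v, X2 u - X2 v, X3 u - X3 v).
Definition scal3 (a : R) (v : R3) : R3 := (a * X1 v, a * X2 v, a * X3 v).
Definition norm3 (v : R3) : R := sqrt (X1 v ^ 2 + X2 v ^ 2 + X3 v ^ 2).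

Definition velocity (p : R -> R3) (t : R) : R3 :=
  (Derive (fun s => X1 (p s)) t,
   Derive (fun s => X2 (p s)) t,
   Derive (fun s => X3 (p s)) t).

(* [Derive] is total, so [is_derive_n u 2 t l] alone would not force [u]
   to be differentiable. *)
Definition has_derive2 (u : R -> R) (t l : R) : Prop :=
  ex_derive u t /\ is_derive_n u 2 t l.

Definition has_acceleration (p : R -> R3) (t : R) (a : R3) : Prop :=
  has_derive2 (fun s => X1 (p s)) t (X1 a) /\
  has_derive2 (fun s => X2 (p s)) t (X2 a) /\
  has_derive2 (fun s => X3 (p s)) t (X3 a).

(* Sum over 0, ..., n: body 0 is x, body j is y^j. *)
Fixpoint sum3 (F : nat -> R3) (n : nat) : R3 :=
  match n with
  | O => F O
  | S p => add3 (sum3 F p) (F (S p))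
  end.

Definition gravity (n : nat) (mass : nat -> R) (q : nat -> R -> R3)
    (i : nat) (t : R) : R3 :=
  sum3 (fun j =>
    if Nat.eqb j i then (0, 0, 0)
    else scal3 (mass j / norm3 (sub3 (q j t) (q i t)) ^ 3)
               (sub3 (q j t) (q i t))) n.

Definition newton (n : nat) (mass : nat -> R) (q : nat -> R -> R3)
    (T : R -> Prop) : Prop :=
  forall t, T t ->
    (forall i j, (i < j <= n)%nat -> q i t <> q j t) /\
    (forall i, (i <= n)%nat ->
       has_acceleration (q i) t (gravity n mass q i t)).

Definition cexp (z : C) : C :=
  Cmult (RtoC (exp (Re z))) (cos (Im z), sin (Im z)).

Definition root_of_unity (n j : nat) : C :=
  cexp (Cmult (RtoC (2 * PI * INR j / INR n)) Ci).

Definition a_complex (n : nat) : C :=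
  sum_n_m (fun j : nat =>
    Cdiv (Cminus (RtoC 1) (root_of_unity n j))
         (RtoC (Cmod (Cminus (root_of_unity n j) (RtoC 1)) ^ 3)))
    1 (n - 1).

(* The sum is real, see [a_complex_real]. *)
Definition a_ (n : nat) : R := Re (a_complex n).

Definition b_ (n : nat) : R :=
  sum_n_m (fun j : nat => / Cmod (Cminus (root_of_unity n j) (RtoC 1)))
    1 (n - 1).

Lemma root_of_unityE (n j : nat) :
  root_of_unity n j =
  (cos (2 * PI * INR j / INR n), sin (2 * PI * INR j / INR n)).
Proof.
unfold root_of_unity. set (x := 2 * PI * INR j / INR n).
replace (Cmult (RtoC x) Ci) with ((0, x) : C)
  by (unfold Cmult, RtoC, Ci; simpl; f_equal; ring).
unfold cexp; simpl Re; simpl Im. rewrite exp_0, Cmult_1_l. reflexivity.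
Qed.

Lemma Im_sum_n_m (F : nat -> C) (p q : nat) :
  Im (sum_n_m F p q) = sum_n_m (fun j => Im (F j)) p q.
Proof.
destruct (Nat.le_gt_cases p q) as [H | H].
- induction H as [| q H IH].
  + now rewrite !sum_n_n.
  + rewrite !sum_n_Sm, <- IH by lia. reflexivity.
- rewrite !sum_n_m_zero by lia. reflexivity.
Qed.

Lemma sum_n_m_rev1 (N : nat) : forall F : nat -> R,
  sum_n_m F 1 N = sum_n_m (fun j => F (S N - j)%nat) 1 N.
Proof.
induction N as [| N IH]; intros F.
- rewrite !sum_n_m_zero by lia. reflexivity.
- rewrite sum_Sn_m, <- sum_n_m_S, (IH (fun j => F (S j))), sum_n_Sm by lia.
  rewrite plus_comm. f_equal.
  + apply sum_n_m_ext_loc; intros j Hj. f_equal; lia.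
  + f_equal; lia.
Qed.

Lemma a_complex_real (n : nat) : Im (a_complex n) = 0.
Proof.
unfold a_complex. rewrite Im_sum_n_m.
destruct n as [| N]; [now rewrite sum_n_m_zero by (simpl; lia) |].
replace (S N - 1)%nat with N by lia.
set (G := fun j : nat => Im _).
assert (HG : forall j, (1 <= j <= N)%nat -> G (S N - j)%nat = - G j).
{ intros j Hj.
  assert (HN : INR (S N) <> 0) by (apply not_0_INR; lia).
  assert (Hc : root_of_unity (S N) (S N - j) =
               Cconj (root_of_unity (S N) j)).
  { rewrite !root_of_unityE, minus_INR by lia. unfold Cconj; simpl fst; simpl snd.
    replace (2 * PI * (INR (S N) - INR j) / INR (S N))
      with (- (2 * PI * INR j / INR (S N)) + 2 * INR 1 * PI)
      by (simpl (INR 1); field; exact HN).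
    now rewrite cos_period, sin_period, cos_neg, sin_neg. }
  unfold G. rewrite Hc.
  set (z := root_of_unity (S N) j).
  replace (Cminus (Cconj z) (RtoC 1)) with (Cconj (Cminus z (RtoC 1)))
    by (unfold Cconj, Cminus, Cplus, Copp, RtoC; simpl; f_equal; ring).
  rewrite Cmod_conj.
  generalize (Cmod (Cminus z (RtoC 1)) ^ 3); intros d.
  unfold Cconj, Cdiv, Cinv, Cminus, Cplus, Copp, Cmult, RtoC, Im; simpl.
  unfold Rdiv. ring. }
enough (H : sum_n_m G 1 N = - sum_n_m G 1 N) by lra.
transitivity (sum_n_m (fun j => (-1) * G j) 1 N).
- rewrite sum_n_m_rev1. apply sum_n_m_ext_loc; intros j Hj.
  change (G (S N - j)%nat = -1 * G j :> R). rewrite HG by exact Hj. ring.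
- rewrite (sum_n_m_mult_l (-1) G).
  change (-1 * sum_n_m G 1 N = - sum_n_m G 1 N :> R). ring.
Qed.

Section Configuration.

Variables (n : nat) (m1 m2 : R) (f r theta : R -> R).

Definition body_x (t : R) : R3 := (0, 0, f t).

Definition body_y (j : nat) (t : R) : R3 :=
  (r t * cos (theta t + 2 * (INR j - 1) * PI / INR n),
   r t * sin (theta t + 2 * (INR j - 1) * PI / INR n),
   - (m1 / (INR n * m2)) * f t).

Definition body (i : nat) : R -> R3 :=
  match i with O => body_x | S _ => body_y i end.

Definition body_mass (i : nat) : R :=
  match i with O => m1 | S _ => m2 end.

Definition k_ : R := (m1 + INR n * m2) / (INR n * m2).

Definition h_ (t : R) : R := sqrt (r t ^ 2 + k_ ^ 2 * f t ^ 2).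

Record ring_solution (c1 : R) (T : R -> Prop) : Prop := {
  ring_newton : newton n body_mass body T;
  ring_r_pos : forall t, T t -> 0 < r t;
  ring_f : forall t, T t ->
    has_derive2 f t (- ((m1 + INR n * m2) * f t / h_ t ^ 3));
  ring_r : forall t, T t ->
    has_derive2 r t
      (c1 ^ 2 / r t ^ 3 - a_ n * (m2 / r t ^ 2) - m1 * r t / h_ t ^ 3);
  ring_theta : forall t, T t ->
    ex_derive theta t /\ r t ^ 2 * Derive theta t = c1
}.

Definition total_energy (t : R) : R :=
  / 2 * (m1 * norm3 (velocity body_x t) ^ 2
         + m2 * sum_n_m (fun j : nat => norm3 (velocity (body_y j) t) ^ 2) 1 n)
  - sum_n_m (fun j : nat =>
      m1 * m2 / norm3 (sub3 (body_x t) (body_y j t))) 1 n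
  - sum_n_m (fun j : nat => sum_n_m (fun i : nat =>
      m2 ^ 2 / norm3 (sub3 (body_y i t) (body_y j t))) 1 (j - 1)) 1 n.

End Configuration.

(* [y] stands for g(r) and [p] for g'(r). *)
Definition coef_a (n : nat) (m1 m2 c1 c2 r y p : R) : R :=
  let N := INR n in
  let h := sqrt (r ^ 2 + k_ n m1 m2 ^ 2 * y ^ 2) in
  - ((2 * N ^ 2 * m1 * m2 ^ 2 * r ^ 2
      + (N ^ 2 * b_ n * m2 ^ 3 * r + 2 * N * c2 * m2 * r ^ 2
         - N ^ 2 * c1 ^ 2 * m2 ^ 2) * h)
     / (r ^ 2 * h * (N ^ 2 * m2 ^ 2 + m1 * (m1 + N * m2) * p ^ 2))).

Definition coef_b (n : nat) (m1 m2 c1 r y : R) : R :=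
  let k := k_ n m1 m2 in
  - (c1 ^ 2 / r ^ 3) + m2 * a_ n / r ^ 2
  + INR n * (k - 1) * m2 * r / Rpower (r ^ 2 + k ^ 2 * y ^ 2) (3 / 2).

Definition coef_c (n : nat) (m1 m2 r y : R) : R :=
  let k := k_ n m1 m2 in
  - (INR n * k * m2 * y / Rpower (r ^ 2 + k ^ 2 * y ^ 2) (3 / 2)).

(* Main.v *)
(** Along the motion [r' <> 0], so [g] is [f] read off against [r], with
    [g' = f'/r'] and [f'' = g'' r'^2 + g' r'']. The equations of motion give
    [b = - r''] and [c = f'']; solving the energy identity for [r'^2] after
    substituting [f' = g' r'] gives [a = - r'^2]. The constant [b_n] enters
    because the potential energy of the regular polygon is
    [- n * b_n * m2 ^ 2 / (2 * r)]. *)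

Require Import Defs.
From Stdlib Require Import Reals Lra Lia.
From Coquelicot Require Import Coquelicot.
Open Scope R_scope.

(** * Open time intervals and injectivity of [r] *)

Lemma time_interval_locally (a b : Rbar) (t : R) :
  time_interval a b t -> locally t (time_interval a b).
Proof.
intros [Ha Hb]. apply filter_and.
- exact (open_Rbar_gt' t a Ha).
- exact (open_Rbar_lt' t b Hb).
Qed.

Lemma time_interval_convex (a b : Rbar) (s t u : R) :
  time_interval a b s -> time_interval a b t ->
  Rmin s t <= u <= Rmax s t -> time_interval a b u.
Proof.
intros [Has Hsb] [Hat Htb] [H1 H2].
unfold Rmin, Rmax in H1, H2; destruct (Rle_dec s t); split.
- now apply (Rbar_lt_le_trans _ s).
- now apply (Rbar_le_lt_trans _ t).
- now apply (Rbar_lt_le_trans _ t).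
- now apply (Rbar_le_lt_trans _ s).
Qed.

(** The mean value theorem turns [r s = r t] into [Derive r c * (t - s) = 0] for some [c] between
    [s] and [t]. This is what makes [g] well defined. *)
Lemma Derive_neq0_inj (a b : Rbar) (r : R -> R) :
  (forall t, time_interval a b t -> ex_derive r t) ->
  (forall t, time_interval a b t -> Derive r t <> 0) ->
  forall s t, time_interval a b s -> time_interval a b t ->
  r s = r t -> s = t.
Proof.
intros Hd H0 s t Hs Ht Hst.
destruct (MVT_gen r s t (Derive r)) as [c [Hc Heq]].
- intros u Hu. apply Derive_correct, Hd.
  apply (time_interval_convex a b s t); auto; lra.
- intros u Hu. apply continuity_pt_filterlim, (ex_derive_continuous r), Hd.
  now apply (time_interval_convex a b s t).
- assert (Hi := H0 c (time_interval_convex a b s t c Hs Ht Hc)).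
  assert (Hz : Derive r c * (t - s) = 0) by lra.
  apply Rmult_integral in Hz. destruct Hz; [contradiction | lra].
Qed.

(** * Differentiation through the change of variable [u = r t] *)

Lemma is_derive_eps (f : R -> R) (x l : R) :
  is_derive f x l <->
  forall eps, 0 < eps ->
    locally x (fun y => Rabs (f y - f x - l * (y - x)) <= eps * Rabs (y - x)).
Proof.
split.
- intros [_ H] eps Heps.
  generalize (H x (fun P HP => HP) (mkposreal eps Heps)). apply filter_imp.
  intros y Hy. revert Hy.
  unfold norm, minus, plus, opp, scal; simpl; unfold abs, mult; simpl.
  intros Hy. replace (f y - f x - l * (y - x))
    with (f y + - f x + - ((y + - x) * l)) by ring. exact Hy.
- intros H. split; [apply is_linear_scal_l |].
  intros z Hz.
  rewrite <- (is_filter_lim_locally_unique _ _ Hz).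
  intros [eps Heps]. generalize (H eps Heps). apply filter_imp.
  intros y Hy. unfold norm, minus, plus, opp, scal; simpl;
    unfold abs, mult; simpl.
  replace (f y + - f x + - ((y + - x) * l))
    with (f y - f x - l * (y - x)) by ring. exact Hy.
Qed.

(** An error of at most [Rabs l / 2 * Rabs (y - x)] leaves half of the linear term. Errors measured
    in [y - x] can then be measured in [r y - r x]. *)
Lemma is_derive_neq0_expanding (r : R -> R) (x l : R) :
  is_derive r x l -> l <> 0 ->
  locally x (fun y => Rabs l / 2 * Rabs (y - x) <= Rabs (r y - r x)).
Proof.
intros H Hl.
assert (Hp : 0 < Rabs l) by now apply Rabs_pos_lt.
generalize (proj1 (is_derive_eps r x l) H (Rabs l / 2) ltac:(lra)).
apply filter_imp; intros y Hy.
assert (H1 : Rabs (l * (y - x)) = Rabs l * Rabs (y - x)) by apply Rabs_mult.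
assert (H2 := Rabs_triang_inv (l * (y - x)) (- (r y - r x - l * (y - x)))).
rewrite Rabs_Ropp in H2.
replace (l * (y - x) - - (r y - r x - l * (y - x))) with (r y - r x) in H2
  by ring.
lra.
Qed.

(** The intermediate value theorem on a small interval around [x] reaches every value near [r x]. It
    asks for continuity near [x], which a derivative at [x] alone does not give. *)
Lemma is_derive_pos_open (r : R -> R) (x l : R) :
  locally x (fun y => continuous r y) -> is_derive r x l -> 0 < l ->
  forall P : R -> Prop, locally x P ->
  locally (r x) (fun u => exists y, P y /\ r y = u).
Proof.
intros Hc Hd Hl P HP.
destruct (filter_and _ _ HP (filter_and _ _ Hc
  (proj1 (is_derive_eps r x l) Hd (l / 2) ltac:(lra)))) as [[d Hd0] H].
simpl in H.
assert (Hball : forall y, Rabs (y - x) < d -> ball x d y)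
  by (intros y Hy; exact Hy).
(* At distance [d / 2] the linear term is [l * d / 2] and the error at most half of it, so [r] moves
   by at least [l * d / 4] on each side. *)
assert (Hlo : r (x - d / 2) <= r x - l * d / 4).
{ destruct (H (x - d / 2)) as [_ [_ H1]].
  { apply Hball. rewrite Rabs_left; lra. }
  replace (x - d / 2 - x) with (- (d / 2)) in H1 by ring.
  rewrite (Rabs_left (- (d / 2))) in H1 by lra.
  apply Rabs_le_between in H1. lra. }
assert (Hhi : r x + l * d / 4 <= r (x + d / 2)).
{ destruct (H (x + d / 2)) as [_ [_ H1]].
  { apply Hball. rewrite Rabs_right; lra. }
  replace (x + d / 2 - x) with (d / 2) in H1 by ring.
  rewrite (Rabs_right (d / 2)) in H1 by lra.
  apply Rabs_le_between in H1. lra. }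
assert (He : 0 < l * d / 4) by (assert (0 < l * d) by nra; lra).
exists (mkposreal _ He). intros u Hu.
change (Rabs (u - r x) < l * d / 4) in Hu. apply Rabs_def2 in Hu.
destruct (Ranalysis5.IVT_interv (fun y => r y - u) (x - d / 2) (x + d / 2))
  as [y [Hy Hy0]]; try lra.
- intros y Hy. apply continuity_pt_minus.
  + apply continuity_pt_filterlim, H, Hball, Rabs_def1; lra.
  + apply continuity_pt_const; now intros ? ?.
- exists y. split; [| lra]. apply H, Hball, Rabs_def1; lra.
Qed.

Lemma is_derive_neq0_open (r : R -> R) (x l : R) :
  locally x (fun y => continuous r y) -> is_derive r x l -> l <> 0 ->
  forall P : R -> Prop, locally x P ->
  locally (r x) (fun u => exists y, P y /\ r y = u).
Proof.
intros Hc Hd Hl P HP.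
destruct (Rdichotomy _ _ Hl) as [Hneg | Hpos];
  [| now apply is_derive_pos_open with l].
(* A negative slope is reduced to a positive one by passing to [- r]. *)
assert (HQ : locally (- r x) (fun u => exists y, P y /\ - r y = u)).
{ apply (is_derive_pos_open (fun y => - r y) x (- l)); auto; try lra.
  - revert Hc; apply filter_imp; intros y Hy.
    now apply (continuous_opp (r : R -> R)).
  - now apply (is_derive_opp r). }
destruct HQ as [d H]. exists d. intros u Hu.
destruct (H (- u)) as [y [Hy Hyu]].
{ change (Rabs (u - r x) < d) in Hu. change (Rabs (- u - - r x) < d).
  replace (- u - - r x) with (- (u - r x)) by ring. now rewrite Rabs_Ropp. }
exists y. split; [assumption | lra].
Qed.

(** No inverse of [r] is constructed: points near [r t] are values [r s] with [s] near [t]. There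
    [f - (df / dr) * r] has derivative 0 at [t], so its increment is small against [s - t], hence
    against [r s - r t]. *)
Lemma is_derive_reparam (f g r : R -> R) (t df dr : R) :
  locally t (fun s => f s = g (r s)) ->
  locally t (fun s => continuous r s) ->
  is_derive f t df -> is_derive r t dr -> dr <> 0 ->
  is_derive g (r t) (df / dr).
Proof.
intros Hfg Hc Hf Hr Hdr.
assert (Hp : 0 < Rabs dr) by now apply Rabs_pos_lt.
assert (Ht := locally_singleton _ _ Hfg); simpl in Ht.
assert (H0 : is_derive (fun s => f s - df / dr * r s) t 0).
{ replace 0 with (df - df / dr * dr) by (field; exact Hdr).
  apply (is_derive_minus f (fun s => df / dr * r s)); auto.
  now apply (is_derive_scal r). }
apply is_derive_eps; intros eps Heps.
(* The factor [Rabs dr / 2] is the expansion constant of [r] at [t]; it is absorbed when [s - t] is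
   replaced by [r s - r t]. *)
assert (He : 0 < eps * (Rabs dr / 2)) by (apply Rmult_lt_0_compat; lra).
generalize (is_derive_neq0_open r t dr Hc Hr Hdr _
  (filter_and _ _ Hfg (filter_and _ _ (is_derive_neq0_expanding r t dr Hr Hdr)
    (proj1 (is_derive_eps _ _ _) H0 _ He)))).
apply filter_imp; intros u [s [[Hs [H1 H2]] Hu]]. subst u.
rewrite <- Hs, <- Ht.
replace (f s - f t - df / dr * (r s - r t))
  with (f s - df / dr * r s - (f t - df / dr * r t) - 0 * (s - t)) by ring.
apply (Rle_trans _ _ _ H2).
rewrite Rmult_assoc. apply Rmult_le_compat_l; lra.
Qed.

(** * Kinetic and potential energy of the configuration *)

Lemma norm3_sq (v : R3) : norm3 v ^ 2 = X1 v ^ 2 + X2 v ^ 2 + X3 v ^ 2.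
Proof.
unfold norm3. rewrite pow2_sqrt; [reflexivity |].
assert (H1 := pow2_ge_0 (X1 v)). assert (H2 := pow2_ge_0 (X2 v)).
assert (H3 := pow2_ge_0 (X3 v)). lra.
Qed.

Lemma sum_n_m_const1 (N : nat) (c : R) :
  sum_n_m (fun _ => c) 1 N = INR N * c.
Proof.
rewrite sum_n_m_const. now replace (S N - 1)%nat with N by lia.
Qed.

Lemma Cmod_root_sub1 (n d : nat) :
  Cmod (Cminus (root_of_unity n d) (RtoC 1)) =
  sqrt (2 - 2 * cos (2 * PI * INR d / INR n)).
Proof.
rewrite root_of_unityE. set (x := 2 * PI * INR d / INR n).
unfold Cmod, Cminus, Cplus, Copp, RtoC; simpl. f_equal.
assert (H := sin2_cos2 x). unfold Rsqr in H. nra.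
Qed.

(** The two roots of unity are conjugate, hence equally far from 1. *)
Lemma Cmod_root_sub1_rev (n d : nat) : (0 < n)%nat -> (d <= n)%nat ->
  Cmod (Cminus (root_of_unity n (n - d)) (RtoC 1)) =
  Cmod (Cminus (root_of_unity n d) (RtoC 1)).
Proof.
intros Hn Hd. rewrite !Cmod_root_sub1, minus_INR by assumption.
assert (HN : INR n <> 0) by (apply not_0_INR; lia).
replace (2 * PI * (INR n - INR d) / INR n)
  with (- (2 * PI * INR d / INR n) + 2 * INR 1 * PI)
  by (simpl (INR 1); field; exact HN).
now rewrite cos_period, cos_neg.
Qed.

(** The ring bodies share their height, so the distance is a chord of a circle of radius [r t],
    which depends only on the difference of the angles. *)
Lemma dist_body_y (n : nat) (m1 m2 : R) (f r theta : R -> R) (i j : nat)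
    (t : R) :
  (0 < n)%nat -> (i <= j)%nat -> 0 <= r t ->
  norm3 (sub3 (body_y n m1 m2 f r theta i t) (body_y n m1 m2 f r theta j t)) =
  r t * Cmod (Cminus (root_of_unity n (j - i)) (RtoC 1)).
Proof.
intros Hn Hij Hr.
assert (HN : INR n <> 0) by (apply not_0_INR; lia).
rewrite Cmod_root_sub1, minus_INR by assumption.
replace (2 * PI * (INR j - INR i) / INR n)
  with ((theta t + 2 * (INR j - 1) * PI / INR n)
        - (theta t + 2 * (INR i - 1) * PI / INR n)) by (field; exact HN).
unfold norm3, sub3, body_y, X1, X2, X3; simpl fst; simpl snd.
set (A := theta t + 2 * (INR i - 1) * PI / INR n).
set (B := theta t + 2 * (INR j - 1) * PI / INR n).
rewrite cos_minus.
transitivity (sqrt (r t ^ 2) * sqrt (2 - 2 * (cos B * cos A + sin B * sin A)));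
  [| now rewrite sqrt_pow2].
rewrite <- sqrt_mult_alt by apply pow2_ge_0. f_equal.
assert (HA := sin2_cos2 A). assert (HB := sin2_cos2 B). unfold Rsqr in HA, HB.
(* Writing 2 as two sums of squares makes the identity polynomial in the sines and cosines. *)
replace (2 - 2 * (cos B * cos A + sin B * sin A))
  with ((sin A * sin A + cos A * cos A) + (sin B * sin B + cos B * cos B)
        - 2 * (cos B * cos A + sin B * sin A)) by lra.
ring.
Qed.

(* The partial sums [T j = phi 1 + ... + phi j] satisfy
   [T (j - 1) + T (n - j) = T (n - 1)]. *)
Lemma sum_pairs_symmetric (n : nat) (phi : nat -> R) :
  (0 < n)%nat ->
  (forall d, (1 <= d < n)%nat -> phi (n - d)%nat = phi d) ->
  2 * sum_n_m (fun j => sum_n_m (fun i => phi (j - i)%nat) 1 (j - 1)) 1 n =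
  INR n * sum_n_m phi 1 (n - 1).
Proof.
intros Hn Hphi. set (T := fun j => sum_n_m phi 1 j : R).
assert (E1 : sum_n_m (fun j => sum_n_m (fun i => phi (j - i)%nat) 1 (j - 1)) 1 n
             = sum_n_m (fun j => T (j - 1)%nat) 1 n).
{ apply sum_n_m_ext_loc; intros j Hj. unfold T.
  rewrite (sum_n_m_rev1 (j - 1) phi).
  apply sum_n_m_ext_loc; intros i Hi. f_equal; lia. }
assert (E2 : sum_n_m (fun j => T (j - 1)%nat) 1 n
             = sum_n_m (fun j => T (n - j)%nat) 1 n).
{ rewrite (sum_n_m_rev1 n (fun j => T (j - 1)%nat)).
  apply sum_n_m_ext_loc; intros j Hj. f_equal; lia. }
(* Passing from [j] to [S j] adds [phi j] to the first sum and removes [phi (n - j)] from the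
   second; the symmetry of [phi] makes these equal. *)
assert (E3 : forall j, (1 <= j <= n)%nat ->
  T (j - 1)%nat + T (n - j)%nat = T (n - 1)%nat).
{ intros j [Hj Hjn]. induction Hj as [| j Hj IH].
  - unfold T. rewrite (sum_n_m_zero phi 1 (1 - 1)) by lia. apply Rplus_0_l.
  - rewrite <- IH by lia.
    replace (S j - 1)%nat with (S (j - 1)) by lia.
    replace (n - j)%nat with (S (n - S j)) by lia.
    unfold T. rewrite !sum_n_Sm by lia.
    replace (S (j - 1)) with j by lia.
    replace (S (n - S j)) with (n - j)%nat by lia.
    rewrite Hphi by lia. unfold plus; simpl. ring. }
rewrite E1.
transitivity (sum_n_m (fun _ => T (n - 1)%nat) 1 n);
  [| apply sum_n_m_const1].
rewrite <- (sum_n_m_ext_loc _ _ _ _ E3).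
etransitivity; [| symmetry; apply (sum_n_m_plus (G := R_AbelianMonoid))].
rewrite <- E2. unfold plus; simpl. ring.
Qed.

(** Each term depends only on [j - i], through a chord length symmetric under [d -> n - d]. The 2 in
    the denominator reflects that [n * b_n] counts every pair twice. *)
Lemma polygon_potential (n : nat) (m1 m2 : R) (f r theta : R -> R) (t : R) :
  (0 < n)%nat -> 0 < r t ->
  sum_n_m (fun j => sum_n_m (fun i =>
      m2 ^ 2 / norm3 (sub3 (body_y n m1 m2 f r theta i t)
                           (body_y n m1 m2 f r theta j t))) 1 (j - 1)) 1 n =
  INR n * b_ n * m2 ^ 2 / (2 * r t).
Proof.
intros Hn Hr.
set (phi := fun d =>
  m2 ^ 2 / r t * / Cmod (Cminus (root_of_unity n d) (RtoC 1))).
rewrite (sum_n_m_ext_loc _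
  (fun j => sum_n_m (fun i => phi (j - i)%nat) 1 (j - 1))).
2:{ intros j Hj. apply sum_n_m_ext_loc; intros i Hi.
    rewrite dist_body_y by (lia || lra). unfold phi.
    unfold Rdiv. rewrite Rinv_mult. symmetry; apply Rmult_assoc. }
assert (H := sum_pairs_symmetric n phi Hn).
assert (Hphi : forall d, (1 <= d < n)%nat -> phi (n - d)%nat = phi d).
{ intros d Hd. unfold phi. now rewrite Cmod_root_sub1_rev by lia. }
specialize (H Hphi).
assert (Hb : sum_n_m phi 1 (n - 1) = m2 ^ 2 / r t * b_ n).
{ exact (sum_n_m_mult_l (m2 ^ 2 / r t)
    (fun d => / Cmod (Cminus (root_of_unity n d) (RtoC 1))) 1 (n - 1)). }
rewrite Hb in H. apply (Rmult_eq_reg_l 2); [| lra]. rewrite H. field. lra.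
Qed.

Lemma norm3_velocity_x (f : R -> R) (t : R) :
  norm3 (velocity (body_x f) t) ^ 2 = Derive f t ^ 2.
Proof.
rewrite norm3_sq. unfold velocity, body_x, X1, X2, X3; simpl fst; simpl snd.
rewrite !Derive_const. change (Derive (fun s => f s) t) with (Derive f t). ring.
Qed.

(** Serves both horizontal coordinates of [body_y], with [w] the cosine or the sine. *)
Lemma Derive_mult_comp_shift (w dw r theta : R -> R) (x t : R) :
  (forall u, is_derive w u (dw u)) -> ex_derive r t -> ex_derive theta t ->
  Derive (fun s => r s * w (theta s + x)) t =
  Derive r t * w (theta t + x) + r t * (Derive theta t * dw (theta t + x)).
Proof.
intros Hw Hr Hth.
assert (Hd : is_derive (fun s => theta s + x) t (Derive theta t)).
{ rewrite <- (Rplus_0_r (Derive theta t)).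
  apply (is_derive_plus theta (fun _ => x)); [now apply Derive_correct |].
  apply (is_derive_const x). }
assert (Hc : is_derive (fun s : R => w (theta s + x)) t
                (Derive theta t * dw (theta t + x)))
  by exact (is_derive_comp w (fun s => theta s + x) t _ _ (Hw _) Hd).
rewrite (Derive_mult r (fun s => w (theta s + x)));
  [| exact Hr | eexists; exact Hc].
now rewrite (is_derive_unique _ _ _ Hc).
Qed.

(** This is the speed in cylindrical coordinates: the radial-angular cross terms cancel, and [j]
    disappears. *)
Lemma norm3_velocity_y (n : nat) (m1 m2 : R) (f r theta : R -> R) (j : nat)
    (t : R) :
  ex_derive f t -> ex_derive r t -> ex_derive theta t ->
  norm3 (velocity (body_y n m1 m2 f r theta j) t) ^ 2 =
  Derive r t ^ 2 + r t ^ 2 * Derive theta t ^ 2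
  + (m1 / (INR n * m2)) ^ 2 * Derive f t ^ 2.
Proof.
intros Hf Hr Hth.
rewrite norm3_sq. unfold velocity, body_y, X1, X2, X3; simpl fst; simpl snd.
set (x := 2 * (INR j - 1) * PI / INR n). set (q := m1 / (INR n * m2)).
rewrite (Derive_mult_comp_shift cos (fun u => - sin u))
  by auto using is_derive_cos.
rewrite (Derive_mult_comp_shift sin cos) by auto using is_derive_sin.
rewrite (Derive_scal f).
assert (H := sin2_cos2 (theta t + x)). unfold Rsqr in H.
set (s := sin (theta t + x)) in *. set (c := cos (theta t + x)) in *.
replace (Derive r t ^ 2 + r t ^ 2 * Derive theta t ^ 2)
  with ((Derive r t ^ 2 + r t ^ 2 * Derive theta t ^ 2) * (s * s + c * c))
  by (rewrite H; ring).
ring.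
Qed.

(** The horizontal separation is [r] and the vertical one [f + m1 / (n * m2) * f = k * f]. *)
Lemma dist_body_x_y (n : nat) (m1 m2 : R) (f r theta : R -> R) (j : nat)
    (t : R) :
  INR n * m2 <> 0 ->
  norm3 (sub3 (body_x f t) (body_y n m1 m2 f r theta j t)) =
  h_ n m1 m2 f r t.
Proof.
intros Hnm. unfold norm3, h_, k_, sub3, body_x, body_y, X1, X2, X3;
  simpl fst; simpl snd. f_equal.
set (x := theta t + 2 * (INR j - 1) * PI / INR n).
assert (H := sin2_cos2 x). unfold Rsqr in H.
replace (r t ^ 2) with (r t ^ 2 * (sin x * sin x + cos x * cos x))
  by (rewrite H; ring).
field. split; intros E; apply Hnm; rewrite E; ring.
Qed.

Lemma total_energyE (n : nat) (m1 m2 : R) (f r theta : R -> R) (t : R) :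
  (0 < n)%nat -> m2 <> 0 -> 0 < r t ->
  ex_derive f t -> ex_derive r t -> ex_derive theta t ->
  total_energy n m1 m2 f r theta t =
  / 2 * (m1 * Derive f t ^ 2
         + INR n * m2 * (Derive r t ^ 2 + r t ^ 2 * Derive theta t ^ 2
                         + (m1 / (INR n * m2)) ^ 2 * Derive f t ^ 2))
  - INR n * m1 * m2 / h_ n m1 m2 f r t
  - INR n * b_ n * m2 ^ 2 / (2 * r t).
Proof.
intros Hn Hm2 Hr Hdf Hdr Hdth.
assert (HN : INR n <> 0) by (apply not_0_INR; lia).
unfold total_energy. rewrite norm3_velocity_x, polygon_potential by assumption.
rewrite (sum_n_m_ext _ (fun _ => Derive r t ^ 2 + r t ^ 2 * Derive theta t ^ 2
    + (m1 / (INR n * m2)) ^ 2 * Derive f t ^ 2))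
  by (intros j; now apply norm3_velocity_y).
rewrite (sum_n_m_ext (fun j => m1 * m2 / _)
    (fun _ => m1 * m2 / h_ n m1 m2 f r t))
  by (intros j; rewrite dist_body_x_y; auto).
rewrite !sum_n_m_const1. unfold Rdiv. ring.
Qed.

(** * The differential equation for [g] *)

Lemma Rpower_3_2 (x : R) : 0 < x -> Rpower x (3 / 2) = sqrt x ^ 3.
Proof.
intros Hx. replace (3 / 2) with (1 + / 2) by lra.
rewrite Rpower_plus, Rpower_1, Rpower_sqrt by assumption.
rewrite <- (sqrt_sqrt x) at 1 by lra. ring.
Qed.

Theorem theorem4p6 (n : nat) (m1 m2 c1 c2 : R) (ta tb : Rbar)
    (f r theta : R -> R)
    (hn : (1 < n)%nat) (hm1 : 0 < m1) (hm2 : 0 < m2)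
    (hsol : ring_solution n m1 m2 f r theta c1 (time_interval ta tb))
    (henergy : forall t, time_interval ta tb t ->
       total_energy n m1 m2 f r theta t = c2)
    (sa sb : Rbar)
    (hsub : forall t, time_interval sa sb t -> time_interval ta tb t)
    (hr : forall t, time_interval sa sb t -> Derive r t <> 0) :
  (exists g : R -> R, forall t, time_interval sa sb t -> f t = g (r t)) /\
  (forall g : R -> R,
     (forall t, time_interval sa sb t -> f t = g (r t)) ->
     forall t, time_interval sa sb t ->
       ex_derive g (r t) /\ ex_derive_n g 2 (r t) /\
       coef_a n m1 m2 c1 c2 (r t) (g (r t)) (Derive g (r t))
         * Derive_n g 2 (r t)
       + coef_b n m1 m2 c1 (r t) (g (r t)) * Derive g (r t)
       + coef_c n m1 m2 (r t) (g (r t)) = 0).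
Proof.
set (I := time_interval sa sb).
assert (Hr' : forall t, I t -> ex_derive r t)
  by (intros t Ht; apply (ring_r _ _ _ _ _ _ _ _ hsol t (hsub t Ht))).
assert (Hf' : forall t, I t -> ex_derive f t)
  by (intros t Ht; apply (ring_f _ _ _ _ _ _ _ _ hsol t (hsub t Ht))).
split.
(* [g u] is the value of [f] at a time where [r] equals [u]; injectivity of [r] makes this value
   unique. *)
{ exists (fun u => iota (fun y => exists s, I s /\ r s = u /\ f s = y)).
  intros t Ht. symmetry.
  apply (iota_unique (V := R_CompleteNormedModule)); [| now exists t].
  intros y [s [Hs [Hrs Hfs]]].
  rewrite <- Hfs. f_equal. now apply (Derive_neq0_inj sa sb r). }
intros g Hg.
assert (Hnear : forall t, I t -> locally t I)
  by (intros t Ht; now apply time_interval_locally).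
assert (Hcont : forall t, I t -> locally t (fun s => continuous r s)).
{ intros t Ht. generalize (Hnear t Ht). apply filter_imp.
  intros s Hs. now apply (ex_derive_continuous r), Hr'. }
(* Proved at all times of [I], since differentiating [g'] once more needs this formula on a
   neighbourhood of [t]. *)
assert (Hg1 : forall t, I t -> is_derive g (r t) (Derive f t / Derive r t)).
{ intros t Ht. apply is_derive_reparam with f; auto using Derive_correct.
  generalize (Hnear t Ht). now apply filter_imp. }
intros t Ht.
destruct (ring_f _ _ _ _ _ _ _ _ hsol t (hsub t Ht)) as [_ Hf2].
destruct (ring_r _ _ _ _ _ _ _ _ hsol t (hsub t Ht)) as [_ Hr2].
destruct (ring_theta _ _ _ _ _ _ _ _ hsol t (hsub t Ht)) as [Hth Hc1].
assert (Hrpos := ring_r_pos _ _ _ _ _ _ _ _ hsol t (hsub t Ht)).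
assert (HE := henergy t (hsub t Ht)).
rewrite total_energyE in HE by (auto; lia || lra).
set (F2 := - ((m1 + INR n * m2) * f t / h_ n m1 m2 f r t ^ 3)) in *.
set (R2 := c1 ^ 2 / r t ^ 3 - _ - _) in *.
change (is_derive (Derive f) t F2) in Hf2.
change (is_derive (Derive r) t R2) in Hr2.
assert (Hrt := hr t Ht).
(* The same change of variable, now with [f' / r'] in place of [f] and [g'] in place of [g]. *)
assert (Hg2 : is_derive (Derive g) (r t)
  ((F2 * Derive r t - Derive f t * R2) / Derive r t ^ 2 / Derive r t)).
{ apply is_derive_reparam with (fun s => Derive f s / Derive r s); auto.
  - generalize (Hnear t Ht). apply filter_imp; intros s Hs.
    symmetry. now apply is_derive_unique, Hg1.
  - now apply is_derive_div.
  - now apply Derive_correct, Hr'. }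
split; [now eexists; apply Hg1 |].
split; [now eexists; apply Hg2 |].
change (Derive_n g 2 (r t)) with (Derive (Derive g) (r t)).
rewrite (is_derive_unique _ _ _ Hg2), (is_derive_unique _ _ _ (Hg1 t Ht)).
rewrite <- (Hg t Ht).
assert (HN : 0 < INR n) by (apply lt_0_INR; lia).
assert (HNm : 0 < INR n * m2) by now apply Rmult_lt_0_compat.
assert (HD : 0 < r t ^ 2 + k_ n m1 m2 ^ 2 * f t ^ 2).
{ assert (H1 : 0 < r t ^ 2) by now apply pow_lt.
  assert (H2 := pow2_ge_0 (k_ n m1 m2 * f t)).
  rewrite Rpow_mult_distr in H2. lra. }
unfold coef_a, coef_b, coef_c. rewrite Rpower_3_2 by exact HD.
fold (h_ n m1 m2 f r t).
assert (Hh : 0 < h_ n m1 m2 f r t) by now apply sqrt_lt_R0.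
set (a' := - _).
(* Inserting the energy for [c2] and [c1 / r ^ 2] for [theta'] leaves [r'^2] times the factor
   [n^2 m2^2 + m1 (m1 + n m2) g'^2] of the denominator. *)
assert (Ha : a' = - Derive r t ^ 2).
{ assert (Hth' : Derive theta t = c1 / r t ^ 2)
    by (rewrite <- Hc1; field; lra).
  unfold a'. rewrite <- HE, Hth'.
  (* This is that factor multiplied by [r'^2], with [g' r' = f']. *)
  assert (Hnz : (INR n * m2 * Derive r t) ^ 2
                + m1 * (m1 + INR n * m2) * Derive f t ^ 2 <> 0).
  { apply Rgt_not_eq, Rplus_lt_le_0_compat.
    - apply pow2_gt_0, Rmult_integral_contrapositive_currified;
        [lra | exact Hrt].
    - apply Rmult_le_pos; [| apply pow2_ge_0].
      apply Rmult_le_pos; lra. }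
  field. repeat split; assumption || lra. }
(* Since [n k m2 = m1 + n m2] and [n (k - 1) m2 = m1], the other coefficients are [- R2] and [F2],
   and all terms cancel. *)
rewrite Ha. unfold F2, R2, k_. field. repeat split; lra.
Qed.
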